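(* The irreducible components of the Hurwitz space $\mathrm{HUR}^{\mathcal S_3}(\mathbb P^1)$ of Galois coverings of $\mathbb P^1$ with Galois group $\mathcal S_3$ are uniquely determined by the monodromy factorization type of the coverings belonging to them; that is, two Galois coverings of $\mathbb P^1$ with Galois group $\mathcal S_3$ having the same monodromy factorization type belong to the same irreducible component.
   Context: A Galois covering with Galois group $G=\mathcal S_3$ is a connected ramified covering $f:C\to\mathbb P^1$ of degree $6$ whose deck transformation group is isomorphic to $\mathcal S_3$ and acts with quotient $\mathbb P^1$. Identifying the fibre over a non-branch point $o$ with $G$, the monodromy $\mu:\pi_1(\mathbb P^1\setminus\{q_1,\dots,q_b\},o)\to\mathcal S_6\simeq\mathrm{Sym}(G)$ has image $G$ embedded by Cayley's embedding $g\mapsto(g_1\mapsto g_1g)$. The local monodromies are $\mu(\gamma_i)$ for a good geometric base, i.e. generators $\gamma_1,\dots,\gamma_b$, $\gamma_i$ going along a path to a point near the branch point $q_i$, around $q_i$ once positively and back, different $\gamma_i$ meeting only at $o$, with $\gamma_1\cdots\gamma_b=\mathbf 1$ (the boundary of a disc containing all $q_i$). The monodromy factorization type of $f$ records, for each non-identity conjugacy class of $\mathcal S_6$, the number of local monodromies lying in it (equivalently, the number of local monodromies that are transpositions in $G=\mathcal S_3$ and the number that are $3$-cycles in $G$). $\mathrm{HUR}_{6,b}(\mathbb P^1)$ is the set of isomorphism classes of degree $6$ coverings of $\mathbb P^1$ with exactly $b$ branch points, with the structure of an unramified covering of $\mathbb P^{(b)}\setminus\Delta$ ($\mathbb P^{(b)}$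 the symmetric product of $b$ copies of $\mathbb P^1$, $\Delta$ the locus of $b$-tuples with coinciding points): the fibre over $B_0$ is the set of $b$-tuples of non-identity elements of $\mathcal S_6$ with product $\mathbf 1$ modulo simultaneous conjugation, and $\pi_1(\mathbb P^{(b)}\setminus\Delta,B_0)$ acts through Hurwitz moves $(\dots,\sigma_i,\sigma_{i+1},\dots)\mapsto(\dots,\sigma_i\sigma_{i+1}\sigma_i^{-1},\sigma_i,\dots)$. Irreducible components are the connected components. $\mathrm{HUR}^{\mathcal S_3}(\mathbb P^1)$ is the union over all $b$ of the components of $\mathrm{HUR}_{6,b}(\mathbb P^1)$ consisting of Galois coverings with Galois group $\mathcal S_3$. *)

(* Defs.v *)
From Stdlib Require Import Relations.
From HB Require Import structures.
From mathcomp Require Import all_boot all_order all_algebra all_fingroup.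

Set Implicit Arguments.
Unset Strict Implicit.
Unset Printing Implicit Defensive.

Import Order.TTheory GRing.Theory Num.Theory.

Section MonodromyTuples.
Variable b : nat.

(* Products of permutations are read from left to right. *)
Definition monodromy_tuple : Type :=
  {t : {ffun 'I_b -> 'S_6} |
    [forall i, t i != 1%g] && (\prod_(i < b) t i == 1)%g}.
HB.instance Definition _ := Choice.on monodromy_tuple.

Definition hurwitz_move (i j : 'I_b) (t : {ffun 'I_b -> 'S_6}) :
    {ffun 'I_b -> 'S_6} :=
  [ffun k => if k == i then (t i * t j * (t i)^-1)%g
             else if k == j then t i else t k].

Definition conj_tuple (s : 'S_6) (t : {ffun 'I_b -> 'S_6}) :
    {ffun 'I_b -> 'S_6} := [ffun k => (t k ^ s)%g].

Definition monodromy_group (t : monodromy_tuple) : {group 'S_6} :=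
  <<[set val t i | i : 'I_b]>>%G.

(* A deck transformation is determined by its action on the fibre over o,
   and a permutation of that fibre comes from a deck transformation iff it
   commutes with the monodromy. *)
Definition deck_group (t : monodromy_tuple) : {group 'S_6} :=
  'C(monodromy_group t)%G.

(* The covering is connected, and the deck group is isomorphic to S_3 and acts
   transitively on the fibre, i.e. with quotient P^1. *)
Definition galois_S3_tuple (t : monodromy_tuple) : Prop :=
  [/\ [transitive (monodromy_group t), on [set: 'I_6] | 'P]%g,
      (deck_group t \isog [set: 'S_3])%g &
      [transitive (deck_group t), on [set: 'I_6] | 'P]%g].

Definition tuple_type (t : monodromy_tuple) (C : {set 'S_6}) : nat :=
  #|[set i | val t i \in C]|.

Lemma classJ_S6 (c x s : 'S_6) :
  (x ^ s \in c ^: [set: 'S_6])%g = (x \in c ^: [set: 'S_6])%g.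
Proof. by rewrite class_sym classGidl ?inE // class_sym. Qed.

Lemma monodromy_group_conj (s : 'S_6) (t t' : monodromy_tuple) :
  val t' = conj_tuple s (val t) ->
  monodromy_group t' :=: (monodromy_group t :^ s)%g.
Proof.
move=> e; rewrite /= -genJ; congr <<_>>%g; rewrite e; apply/setP => x.
apply/imsetP/imsetP => [[i _ ->]|[y /imsetP[i _ ->] ->]].
  by exists (val t i); [apply/imsetP; exists i | rewrite ffunE].
by exists i; rewrite ?ffunE.
Qed.

Lemma monodromy_group_hurwitz (i j : 'I_b) (t t' : monodromy_tuple) :
  i != j -> val t' = hurwitz_move i j (val t) ->
  monodromy_group t' :=: monodromy_group t.
Proof.
move=> ij e; apply/eqP; rewrite eqEsubset !gen_subG; apply/andP; split.
  apply/subsetP => _ /imsetP[k _ ->]; rewrite e ffunE.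
  have T l : val t l \in <<[set val t i | i : 'I_b]>>%g.
    by apply/mem_gen/imsetP; exists l.
  by case: ifP => _; [rewrite !groupM ?groupV | case: ifP].
have T l : val t' l \in <<[set val t' i | i : 'I_b]>>%g.
  by apply/mem_gen/imsetP; exists l.
have ti : val t i \in monodromy_group t'.
  by have := T j; rewrite {1}e ffunE eq_sym (negbTE ij) eqxx.
apply/subsetP => _ /imsetP[k _ ->].
have [->//|ki] := eqVneq k i; have [->|kj] := eqVneq k j.
  have := T i; rewrite {1}e ffunE eqxx.
  by rewrite groupMr ?groupV// groupMl.
by have := T k; rewrite {1}e ffunE (negbTE ki) (negbTE kj).
Qed.

Lemma galois_S3_tuple_conj (s : 'S_6) (t t' : monodromy_tuple) :
  monodromy_group t' :=: (monodromy_group t :^ s)%g ->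
  galois_S3_tuple t -> galois_S3_tuple t'.
Proof.
move=> e [trm iso trd].
have ed : deck_group t' :=: (deck_group t :^ s)%g by rewrite /= e centJ.
have trJ (H K : {group 'S_6}) : H :=: (K :^ s)%g ->
    [transitive K, on [set: 'I_6] | 'P]%g ->
    [transitive H, on [set: 'I_6] | 'P]%g.
  move=> -> trK; apply/imsetP; exists (s ord0); rewrite ?inE //.
  apply/esym/setP => x; rewrite [RHS]inE.
  have -> : x = 'P%act ((s^-1)%g x) s by rewrite /= /aperm permKV.
  by rewrite -[s ord0]/('P%act ord0 s) orbit_conjsg (atransP trK) ?inE.
split; [exact: trJ e trm | | exact: trJ ed trd].
rewrite ed; apply: isog_trans iso; rewrite isog_sym; exact: conj_isog.
Qed.

Lemma tuple_type_conj (s : 'S_6) (t t' : monodromy_tuple) (C : {set 'S_6}) :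
  C \in classes [set: 'S_6] -> val t' = conj_tuple s (val t) ->
  tuple_type t' C = tuple_type t C.
Proof.
move=> /imsetP[c _ ->] e; apply: eq_card => i; rewrite !inE e ffunE.
by rewrite classJ_S6.
Qed.

Lemma tuple_type_hurwitz (i j : 'I_b) (t t' : monodromy_tuple)
    (C : {set 'S_6}) :
  C \in classes [set: 'S_6] -> i != j ->
  val t' = hurwitz_move i j (val t) -> tuple_type t' C = tuple_type t C.
Proof.
move=> /imsetP[c _ ->] ij e; rewrite /tuple_type.
rewrite -(card_imset _ (@perm_inj _ (tperm i j))); apply: eq_card => k.
rewrite !inE -{1}[k](tpermK i j) mem_imset ?inE; last exact: perm_inj.
rewrite e ffunE; case: tpermP => [->|->|/eqP/negbTE ki /eqP/negbTE kj].
- by rewrite eq_sym (negbTE ij) eqxx.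
- by rewrite eqxx -{1}[val t i]invgK -mulgA -/(conjg _ _) classJ_S6.
- by rewrite ki kj.
Qed.

End MonodromyTuples.

Definition nonid_classes : {set {set 'S_6}} :=
  (classes [set: 'S_6] :\ [set 1])%g.

From mathcomp Require Import generic_quotient.
From mathcomp Require Import all_classical all_reals all_analysis.

Import numFieldNormedType.Exports.

Local Open Scope classical_set_scope.
Local Open Scope ring_scope.
Local Open Scope quotient_scope.

Section SymmetricProduct.
Variables (R : realType) (b : nat).

(* The complex projective line as the Riemann sphere; (x, y) is x + iy. *)
Definition P1 : Type := one_point_compactification (R * R)%type.
HB.instance Definition _ := Topological.on P1.

Definition P1pow : Type := prod_topology (fun _ : 'I_b => P1).
HB.instance Definition _ := Topological.on P1pow.

Definition sym_rel (x y : P1pow) : bool :=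
  `[< exists s : 'S_b, forall i, y i = x (s i) >].

Lemma sym_rel_refl : reflexive sym_rel.
Proof. by move=> x; apply/asboolP; exists 1%g => i; rewrite perm1. Qed.

Lemma sym_rel_sym : symmetric sym_rel.
Proof.
suff H x y : sym_rel x y -> sym_rel y x by move=> x y; apply/idP/idP; exact: H.
move=> /asboolP[s xy]; apply/asboolP; exists s^-1%g => i.
by rewrite xy permKV.
Qed.

Lemma sym_rel_trans : transitive sym_rel.
Proof.
move=> y x z /asboolP[s xy] /asboolP[u yz]; apply/asboolP; exists (u * s)%g => i.
by rewrite yz xy permM.
Qed.

Definition sym_equiv := EquivRel _ sym_rel_refl sym_rel_sym sym_rel_trans.

Definition sym_prod : Type := {eq_quot sym_equiv}.
HB.instance Definition _ := Topological.copy sym_prod (quotient_topology {eq_quot sym_equiv}).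
HB.instance Definition _ := Quotient.on sym_prod.

Definition big_diagonal : set sym_prod :=
  [set \pi_sym_prod x | x in [set x : P1pow | ~ injective x]].

Definition conf : set sym_prod := ~` big_diagonal.

(* The base configuration {0, 1, ..., b - 1}, on the real axis. *)
Definition base_conf : sym_prod :=
  \pi_sym_prod ((fun i : 'I_b => Some ((i : nat)%:R, 0)) : P1pow).

(* For j = i + 1: the points i and i + 1 exchange places along half circles,
   clockwise, so that the one leaving i passes above. The good geometric base
   at base_conf is the one whose loops descend vertically from a base point o
   far up the imaginary axis: then gamma_0 ... gamma_(b-1), composed from left
   to right, is the positive boundary of a disc containing the configuration,
   and the transport along this loop is exactly the move
   (s_i, s_(i+1)) |-> (s_i s_(i+1) s_i^-1, s_i). *)
Definition half_twist (i j : 'I_b) (u : R) : sym_prod :=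
  let c : R := (i : nat)%:R + 2^-1 in
  \pi_sym_prod ((fun k : 'I_b =>
    if k == i then Some (c - cos (pi * u) / 2, sin (pi * u) / 2)
    else if k == j then Some (c + cos (pi * u) / 2, - (sin (pi * u) / 2))
    else Some ((k : nat)%:R, 0)) : P1pow).

(* A path is parametrized by R, but only its restriction to [0, 1] matters. *)
Record conf_path := ConfPath {
  path_fun :> R -> sym_prod ;
  path_continuous : continuous path_fun ;
  path_conf : forall u, conf (path_fun u) ;
  path_base : path_fun 0 = base_conf }.

HB.instance Definition _ := gen_eqMixin conf_path.
HB.instance Definition _ := gen_choiceMixin conf_path.
HB.instance Definition _ := Topological.copy conf_path
  (@initial_topology conf_path {compact-open, R -> sym_prod} path_fun).

Definition path_homotopic (p q : conf_path) : Prop :=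
  exists H : R * R -> sym_prod,
    [/\ continuous H /\ (forall z, conf (H z)),
        (forall u, 0 <= u <= 1 -> H (0, u) = p u /\ H (1, u) = q u) &
        (forall s, 0 <= s <= 1 -> H (s, 0) = base_conf /\ H (s, 1) = p 1)].

Definition half_twist_then (i j : 'I_b) (p q : conf_path) : Prop :=
  (forall u, 0 <= u <= 2^-1 -> q u = half_twist i j (2 * u)) /\
  (forall u, 2^-1 <= u <= 1 -> q u = p (2 * u - 1)).

End SymmetricProduct.

Section HurwitzSpace.
Variables (R : realType) (b : nat).

Definition hur_pre : Type :=
  (conf_path R b * discrete_topology (monodromy_tuple b))%type.
HB.instance Definition _ := Topological.on hur_pre.

(* (p, t) stands for the covering obtained by transporting, along the path p
   from base_conf, the covering branched over base_conf with local monodromies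
   t in the good geometric base. The quotient below is the covering of conf
   associated with the action of its fundamental group (which is generated by
   the half twists) on tuples modulo conjugation: universal covering (homotopy
   classes of paths, with the quotient of the compact-open topology) times the
   discrete fibre, modulo the diagonal action. *)
Inductive hur_step : hur_pre -> hur_pre -> Prop :=
| hur_homotopy (p q : conf_path R b) (t : monodromy_tuple b) :
    path_homotopic p q -> hur_step (p, t) (q, t)
| hur_conj (p : conf_path R b) (s : 'S_6) (t t' : monodromy_tuple b) :
    val t' = conj_tuple s (val t) -> hur_step (p, t) (p, t')
| hur_hurwitz (i j : 'I_b) (p q : conf_path R b) (t t' : monodromy_tuple b) :
    (j : nat) = i.+1 -> half_twist_then i j p q ->
    val t' = hurwitz_move i j (val t) -> hur_step (q, t) (p, t').

Definition hur_rel (x y : hur_pre) : bool :=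
  `[< clos_refl_sym_trans hur_pre hur_step x y >].

Lemma hur_rel_refl : reflexive hur_rel.
Proof. by move=> x; apply/asboolP/rst_refl. Qed.

Lemma hur_rel_sym : symmetric hur_rel.
Proof. by move=> x y; apply/asboolP/asboolP => h; apply: rst_sym. Qed.

Lemma hur_rel_trans : transitive hur_rel.
Proof.
by move=> y x z /asboolP xy /asboolP yz; apply/asboolP; apply: rst_trans yz.
Qed.

Definition hur_equiv := EquivRel _ hur_rel_refl hur_rel_sym hur_rel_trans.

Definition HUR6 : Type := {eq_quot hur_equiv}.
HB.instance Definition _ := Topological.copy HUR6 (quotient_topology {eq_quot hur_equiv}).
HB.instance Definition _ := Quotient.on HUR6.

Definition fibre_tuple (h : HUR6) : monodromy_tuple b := (repr h).2.

(* Neither property read off fibre_tuple depends on the representative. *)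
Lemma galois_S3_tuple_pi (x : hur_pre) :
  galois_S3_tuple (fibre_tuple (\pi_HUR6 x)) <-> galois_S3_tuple x.2.
Proof.
have neq (i j : 'I_b) : (j : nat) = i.+1 -> i != j.
  by move=> ji; rewrite -val_eqE /= ji neq_ltn ltnSn.
have : hur_equiv (repr (\pi_HUR6 x)) x by apply/eqmodP; rewrite reprK.
move=> /asboolP; rewrite /fibre_tuple; set y := repr _; move: y => y.
elim=> {x y} [x y [p q t _|p s t t' e|i j p q t t' ji _ e]|x|x y _ h|
  x y z _ h _ k] //=; [| |by split=> /h|by rewrite h].
- have g := monodromy_group_conj e.
  split; first exact: galois_S3_tuple_conj g.
  by apply: (@galois_S3_tuple_conj _ s^-1%g); rewrite g conjsgK.
- have g := monodromy_group_hurwitz (neq _ _ ji) e.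
  by split; apply: (@galois_S3_tuple_conj _ 1%g); rewrite conjsg1 g.
Qed.

Lemma tuple_type_pi (x : hur_pre) :
  {in nonid_classes, tuple_type (fibre_tuple (\pi_HUR6 x)) =1 tuple_type x.2}.
Proof.
have neq (i j : 'I_b) : (j : nat) = i.+1 -> i != j.
  by move=> ji; rewrite -val_eqE /= ji neq_ltn ltnSn.
move=> C /finset.setD1P[_ CS].
have : hur_equiv (repr (\pi_HUR6 x)) x by apply/eqmodP; rewrite reprK.
move=> /asboolP; rewrite /fibre_tuple; set y := repr _; move: y => y.
elim=> {x y} [x y [p q t _|p s t t' e|i j p q t t' ji _ e]|x|x y _ h|
  x y z _ h _ k] //=; [| |by rewrite h].
- by rewrite (tuple_type_conj CS e).
- by rewrite (tuple_type_hurwitz CS (neq _ _ ji) e).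
Qed.

End HurwitzSpace.

Definition HUR (R : realType) : Type := {b : nat & HUR6 R b}.
HB.instance Definition _ (R : realType) := Topological.on (HUR R).

Section Components.
Variable R : realType.

Definition galois_S3 (h : HUR R) : Prop :=
  galois_S3_tuple (fibre_tuple (projT2 h)).

Definition monodromy_type (h : HUR R) : {set 'S_6} -> nat :=
  tuple_type (fibre_tuple (projT2 h)).

Definition same_monodromy_type (h h' : HUR R) : Prop :=
  {in nonid_classes, monodromy_type h =1 monodromy_type h'}.

Definition HUR_S3 : set (HUR R) := [set h | galois_S3 h].

(* A covering space of a manifold: irreducible components are the connected
   components. *)
Definition irreducible_component (Z : set (HUR R)) : Prop :=
  exists2 h, HUR_S3 h & Z = connected_component HUR_S3 h.

End Components.

(* Main.v *)
Require Import Defs.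
From Stdlib Require Import Relations.
From HB Require Import structures.
From mathcomp Require Import all_boot all_fingroup all_solvable.

(* The monodromy group of a Galois covering with group S_3 and its deck group
   are two transitive subgroups of S_6 that centralise each other; both are
   therefore regular, of order 6 and non-abelian, so any two such monodromy
   groups are conjugate in S_6, and a tuple becomes a word in the dihedral
   group of order 6.

   In such a word, Hurwitz moves bring the rotations to the front. Carrying a
   rotation past a reflection and back inverts it, so all rotations may be taken
   equal to r. A word of at least three reflections that are not all equal has a
   normal form depending only on its length and its product, and if the
   reflections are all equal, some rotation (inverted twice) makes them
   different. Two reflections with a given product are unique up to
   conjugation by rotations. The total product being 1, the numbers of rotations
   and reflections determine the word up to Hurwitz moves and conjugation.

   In the Hurwitz space, shrinking the path p joins the class of (p, t) to that
   of (constant path, t). Applied to a half-twist loop, this puts the classes of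
   (constant path, t) and (constant path, t') in the same component whenever t'
   is obtained from t by a Hurwitz move. *)

Set Implicit Arguments.
Unset Strict Implicit.
Unset Printing Implicit Defensive.

(** * Hurwitz equivalence of words in the dihedral group of order 6 *)

(** A bare enumeration rather than ['Z_3], so that identities and searches in the dihedral group
    reduce to case analysis and computation. *)
Variant z3 := Z0 | Z1 | Z2.

Definition z3_opt (k : z3) : option bool :=
  match k with Z0 => None | Z1 => Some false | Z2 => Some true end.
Definition opt_z3 (o : option bool) : z3 :=
  match o with None => Z0 | Some false => Z1 | Some true => Z2 end.
Lemma z3_optK : cancel z3_opt opt_z3. Proof. by case. Qed.
HB.instance Definition _ := Choice.copy z3 (can_type z3_optK).

Definition z3add (k l : z3) : z3 :=
  match k, l with
  | Z0, _ => l | _, Z0 => k | Z1, Z1 => Z2 | Z2, Z2 => Z1 | _, _ => Z0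
  end.
Definition z3opp (k : z3) : z3 :=
  match k with Z0 => Z0 | Z1 => Z2 | Z2 => Z1 end.

(* [(false, k)] is the rotation [r^k], [(true, k)] the reflection [r^k s]. *)
Local Notation d3 := (bool * z3)%type.
Definition d3one : d3 := (false, Z0).
Definition d3mul (a b : d3) : d3 :=
  (a.1 (+) b.1, z3add a.2 (if a.1 then z3opp b.2 else b.2)).
Definition d3inv (a : d3) : d3 := (a.1, if a.1 then a.2 else z3opp a.2).
Definition d3conj (a b : d3) : d3 := d3mul (d3mul a b) (d3inv a).
Definition d3prod (w : seq d3) : d3 := foldr d3mul d3one w.

Ltac d3cases := repeat match goal with x : d3 |- _ => case: x => [[] []] end.

Lemma d3mulA : associative d3mul. Proof. by move=> a b c; d3cases. Qed.
Lemma d3mul1 a : d3mul d3one a = a. Proof. by d3cases. Qed.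
Lemma d3mulr1 a : d3mul a d3one = a. Proof. by d3cases. Qed.
Lemma d3mulKI a : cancel (d3mul a) (d3mul (d3inv a)).
Proof. by move=> b; d3cases. Qed.
Lemma d3conjK a b : d3mul (d3conj a b) a = d3mul a b.
Proof. by d3cases. Qed.
Lemma d3conj_eq1 a b : (d3conj a b == d3one) = (b == d3one).
Proof. by d3cases. Qed.
Lemma d3conj1 a : d3conj d3one a = a. Proof. by d3cases. Qed.
Lemma d3conjM g a b : d3conj g (d3conj a b) = d3conj (d3conj g a) (d3conj g b).
Proof. by d3cases. Qed.

Lemma d3prod_cat u v : d3prod (u ++ v) = d3mul (d3prod u) (d3prod v).
Proof. by elim: u => [|a u IH] /=; rewrite ?d3mul1 // IH d3mulA. Qed.

(** * Hurwitz moves on words and their invariants *)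

Inductive hstep : seq d3 -> seq d3 -> Prop :=
  HStep u a b v : hstep (u ++ a :: b :: v) (u ++ d3conj a b :: a :: v).

Definition heq : seq d3 -> seq d3 -> Prop := clos_refl_sym_trans _ hstep.

Lemma heq_refl w : heq w w. Proof. exact: rst_refl. Qed.
Lemma heq_sym u v : heq u v -> heq v u. Proof. exact: rst_sym. Qed.
Lemma heq_trans v u w : heq u v -> heq v w -> heq u w.
Proof. exact: rst_trans. Qed.
#[local] Hint Resolve heq_refl : core.

Lemma heq_map (f : seq d3 -> seq d3) :
  (forall u v, hstep u v -> hstep (f u) (f v)) ->
  forall u v, heq u v -> heq (f u) (f v).
Proof.
move=> fS u v; elim=> [x y /fS|x|x y _|x y z _ xy _ yz] //.
- exact: rst_step.
- exact: heq_sym.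
- exact: heq_trans xy yz.
Qed.

Lemma heq_catl x u v : heq u v -> heq (x ++ u) (x ++ v).
Proof.
by apply: heq_map => _ _ [u' a b v']; rewrite !catA; apply: HStep.
Qed.

Lemma heq_catr y u v : heq u v -> heq (u ++ y) (v ++ y).
Proof.
apply: (heq_map (f := cat^~ y)) => _ _ [u' a b v'] /=.
by rewrite -!catA; apply: HStep.
Qed.

Lemma heq_cons a u v : heq u v -> heq (a :: u) (a :: v).
Proof. exact: (heq_catl [:: a]). Qed.

Lemma heq_conj g u v : heq u v -> heq (map (d3conj g) u) (map (d3conj g) v).
Proof.
apply: heq_map => _ _ [u' a b v'] /=.
by rewrite !map_cat /= d3conjM; apply: HStep.
Qed.

Lemma heq_swap a b v : heq (a :: b :: v) (d3conj a b :: a :: v).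
Proof. exact/rst_step/(HStep [::]). Qed.

Lemma heq_invariant (T : Type) (f : seq d3 -> T) :
  (forall u v, hstep u v -> f u = f v) -> forall u v, heq u v -> f u = f v.
Proof. by move=> fS u v; elim=> [x y /fS|x|x y _ ->|x y z _ -> _ ->]. Qed.

Lemma heq_size u v : heq u v -> size u = size v.
Proof.
by apply: heq_invariant => _ _ [u' a b v']; rewrite !size_cat.
Qed.

Lemma heq_prod u v : heq u v -> d3prod u = d3prod v.
Proof.
apply: heq_invariant => _ _ [u' a b v'].
by rewrite !d3prod_cat /= !(d3mulA _ _ (d3prod v')) d3conjK.
Qed.

Lemma heq_count u v : heq u v -> count fst u = count fst v.
Proof.
apply: heq_invariant => _ _ [u' a b v'].
by rewrite !count_cat; d3cases.
Qed.

Lemma heq_nonid u v : heq u v -> all (predC1 d3one) u = all (predC1 d3one) v.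
Proof.
apply: heq_invariant => _ _ [u' a b v'].
by rewrite !all_cat /= d3conj_eq1 (andbCA (a != _)).
Qed.

Lemma constant_pair (T : eqType) (u v : seq T) a b :
  constant (u ++ a :: b :: v) -> a = b.
Proof.
case/(constantP a) => x e.
have ux y : y \in u ++ a :: b :: v -> y = x.
  by rewrite {1}e => /nseqP[].
by transitivity x; [|symmetry]; apply: ux; rewrite mem_cat !inE eqxx !orbT.
Qed.

(** A move fixes a pair of equal letters, and conversely [d3conj a b = a] forces [b = a]. *)
Lemma heq_constant u v : heq u v -> constant u = constant v.
Proof.
apply: heq_invariant => _ _ [u' a b v'].
have conj_id c : d3conj c c = c by d3cases.
apply/idP/idP => c; have e := constant_pair c.
  by move: c; rewrite -e conj_id.
have ba : b = a by move: e {c}; d3cases.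
by move: c; rewrite ba conj_id.
Qed.

(** * Equivalences of short words by computation *)

Fixpoint hmove n (w : seq d3) : seq d3 :=
  match n, w with
  | 0, a :: b :: v => d3conj a b :: a :: v
  | n'.+1, a :: v => a :: hmove n' v
  | _, _ => w
  end.

Lemma hmove_heq n w : heq w (hmove n w).
Proof.
elim: n w => [|n IH] [|a [|b v]] //=; first exact: heq_swap.
- by apply: heq_cons; apply: IH.
- by apply: heq_cons; apply: IH.
Qed.

(** A search through at most [d] moves. Forward moves permute the finite set of words of a given
    length, so with enough depth they also reach what inverse moves reach. *)
Fixpoint hreach d (w w' : seq d3) : bool :=
  (w == w') || (if d is d'.+1 then
    has (fun n => hreach d' (hmove n w) w') (iota 0 (size w).-1) else false).

Lemma hreach_heq d w w' : hreach d w w' -> heq w w'.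
Proof.
elim: d w => [|d IH] w /= /orP[/eqP->|//] //.
by case/hasP=> n _ /IH; apply/heq_trans/hmove_heq.
Qed.

(** * Normal forms of words *)

Local Notation Rot k := (false, k).
Local Notation Ref k := (true, k).
Local Notation refs := (map (pair true)).
Local Notation rots := (map (pair false)).

(** Each move carries the reflection unchanged past one rotation, which it inverts. *)
Lemma heq_ref_rots i ks :
  heq (Ref i :: rots ks) (rots (map z3opp ks) ++ [:: Ref i]).
Proof.
elim: ks => [|k ks IH] //=.
apply: heq_trans (heq_swap _ _ _) _.
have -> : d3conj (Ref i) (Rot k) = Rot (z3opp k) by case: (i); case: (k).
exact: heq_cons.
Qed.

Lemma heq_sort w : exists ks ls, heq w (rots ks ++ refs ls).
Proof.
elim: w => [|[e k] w [ks [ls IH]]]; first by exists [::], [::].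
case: e; last by exists (k :: ks), ls; apply: heq_cons.
exists (map z3opp ks), (k :: ls).
apply: heq_trans (heq_cons _ IH) _.
by rewrite -cat_cons map_cons -cat_rcons -cats1; apply/heq_catr/heq_ref_rots.
Qed.

Lemma nseq_rcons (T : Type) n (x : T) : nseq n x ++ [:: x] = nseq n.+1 x.
Proof. by rewrite -addn1 nseqD. Qed.

Lemma heq_rot_nseq k l m :
  heq (Rot k :: nseq m (Rot l)) (nseq m (Rot l) ++ [:: Rot k]).
Proof.
elim: m => [|m IH] //=; apply: heq_trans (heq_swap _ _ _) _.
have -> : d3conj (Rot k) (Rot l) = Rot l by case: (k); case: (l).
exact: heq_cons.
Qed.

(* Carrying a rotation to the other side of a reflection and back inverts it. *)
Lemma heq_rots ks i ls : Z0 \notin ks ->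
  exists i', heq (rots ks ++ refs (i :: ls))
                 (nseq (size ks) (Rot Z1) ++ refs (i' :: ls)).
Proof.
elim: ks => [|k ks IH]; first by exists i.
rewrite inE negb_or => /andP[k0 /IH[i' {}IH]].
have h := heq_cons (Rot k) IH.
case: k k0 h => // _ h; first by exists i'.
(* Forced by the product: [r^2 r^i' s = r r^(i'+1) s]. *)
exists (z3add i' Z1); apply: heq_trans h _.
have : heq ([:: Rot Z2; Ref i']) ([:: Rot Z1; Ref (z3add i' Z1)]).
  by apply: (@hreach_heq 3); case: i' {IH}; vm_compute.
move=> h; rewrite -cat_cons [size _]/=.
(* Rotations commute, so [Rot Z2] can be brought next to the reflection before it is inverted. *)
apply: heq_trans (heq_catr _ (heq_rot_nseq _ _ _)) _.
rewrite -nseq_rcons -!catA; apply: heq_catl.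
exact: (heq_catr (refs ls) h).
Qed.

Lemma heq_rot_refs w : all (predC1 d3one) w -> (0 < count fst w)%N ->
  exists i ls, heq w (nseq (size w - count fst w) (Rot Z1) ++ refs (i :: ls))
    /\ count fst w = (size ls).+1.
Proof.
move=> w1 w0; have [ks [ls h]] := heq_sort w.
have c : count fst w = size ls.
  rewrite (heq_count h) count_cat !count_map /=.
  by rewrite (eq_count (a2 := pred0)) // count_pred0 count_predT.
have s : size w = (size ks + size ls)%N.
  by rewrite (heq_size h) size_cat !size_map.
move: w1; rewrite (heq_nonid h) all_cat => /andP[k0 _].
case: ls c s h => [|i ls] c s h; first by rewrite c in w0.
have [|i' h'] := @heq_rots ks i ls.
  apply/negP => /(map_f (pair false)) kz.
  by have /= := allP k0 _ kz.
exists i', ls; rewrite c s addnK; split=> //.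
exact: heq_trans h h'.
Qed.

(* The last three reflections of the normal form of a non-constant word. *)
Definition ref_triple (p : z3) : seq z3 :=
  if p is Z0 then [:: Z0; Z1; Z1] else [:: Z0; Z0; p].

(** The product of the three reflections is [r^(i-j+k) s], and [ref_triple p] has product [r^p s],
    which dictates the value of [p]. *)
Lemma heq_triple i j k : ~~ constant [:: i; j; k] ->
  heq (refs [:: i; j; k]) (refs (ref_triple (z3add i (z3add (z3opp j) k)))).
Proof.
move=> ijk; apply: (@hreach_heq 6).
by move: ijk; case: i; case: j; case: k => //; vm_compute.
Qed.

Lemma heq_cons_triple i p :
  exists q, heq (refs (i :: ref_triple p)) (refs (Z0 :: ref_triple q)).
Proof.
(* The two sides have products [r^(i-p)] and [r^(-q)]. *)
exists (z3add p (z3opp i)).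
by apply: (@hreach_heq 7); case: i; case: p; vm_compute.
Qed.

(** Passing one zero replaces [i] by its opposite, as the product [r^i] of the pair requires. *)
Lemma heq_ref_zeros i n :
  exists j, heq (refs (i :: nseq n Z0)) (refs (nseq n Z0 ++ [:: j])).
Proof.
elim: n i => [|n IH] i /=; first by exists i.
have [j h] := IH (z3opp i); exists j.
apply: heq_trans (heq_cons _ h) .
apply: (heq_catr _ (_ : heq [:: _; _] [:: _; _])).
by apply: (@hreach_heq 3); case: (i); vm_compute.
Qed.

Lemma heq_refs n ls : size ls = n.+3 -> ~~ constant ls ->
  exists p, heq (refs ls) (refs (nseq n Z0 ++ ref_triple p)).
Proof.
elim: n ls => [|n IH] ls.
  case: ls => [|i [|j [|k []]]] // _ nc.
  by exists (z3add i (z3add (z3opp j) k)); apply: heq_triple.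
(* A non-constant tail is normalised first. The leading reflection then passes the zeros of the tail
   and is absorbed by the final triple, which releases one more zero. *)
have tail_case a ls' : size ls' = n.+3 -> ~~ constant ls' ->
  exists p, heq (refs (a :: ls')) (refs (nseq n.+1 Z0 ++ ref_triple p)).
  move=> s /(IH _ s)[p h]; have [j hj] := heq_ref_zeros a n.
  have [q hq] := heq_cons_triple j p; exists q.
  apply: heq_trans (heq_cons _ h) _.
  rewrite -map_cons -cat_cons map_cat; apply: heq_trans (heq_catr _ hj) _.
  rewrite map_cat -catA -map_cat; apply: heq_trans (heq_catl _ hq) _.
  by rewrite -map_cat -cat_rcons -cats1 nseq_rcons.
case: ls => [|a ls] // [s].
have [/(constantP Z0)[c ->]|nc _] := boolP (constant ls); last exact: tail_case.
rewrite s => nc; have ac : a != c.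
  by apply: contraNneq nc => ->; apply: (constant_nseq n.+4).
(* The tail being constant, the pair [a], [c] is replaced by [c], [-a-c], of the same product. For
   [a != c] the third reflection [-a-c] differs from [c], so the new tail is not constant. *)
have [||p hp] := tail_case c ([:: z3add (z3opp a) (z3opp c), c & nseq n.+1 c]);
  first by rewrite /= size_nseq.
  by case: a c {nc} ac => [] [].
exists p; apply: heq_trans hp.
apply: (heq_catr _ (_ : heq [:: _; _] [:: _; _])); apply: (@hreach_heq 3).
by case: a c {nc} ac => [] [] //; vm_compute.
Qed.

Lemma ref_triple_prod_inj : injective (fun p => d3prod (refs (ref_triple p))).
Proof. by case=> [] []. Qed.

Definition normal_word m n p : seq d3 :=
  nseq m (Rot Z1) ++ refs (nseq n Z0 ++ ref_triple p).

Lemma normal_word_prod_inj m n :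
  injective (fun p => d3prod (normal_word m n p)).
Proof.
move=> p q; rewrite /normal_word !map_cat !d3prod_cat.
by move/(can_inj (@d3mulKI _))/(can_inj (@d3mulKI _))/ref_triple_prod_inj.
Qed.

Lemma heq_normal_word w n :
  all (predC1 d3one) w -> count fst w = n.+3 -> ~~ constant w ->
  exists p, heq w (normal_word (size w - n.+3) n p).
Proof.
move=> w1 wn wc; have [|i [ls []]] := heq_rot_refs w1; first by rewrite wn.
rewrite wn => h [ls_n].
have [c|nc] := boolP (constant (i :: ls)); last first.
  have [|p hp] := @heq_refs n (i :: ls) _ nc; first by rewrite /= ls_n.
  by exists p; apply: heq_trans h _; apply: heq_catl.
(* Without rotations, [w] would be equivalent to a constant word, hence constant. *)
case m : (size w - n.+3)%N h => [|m'] h.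
  case/negP: wc; rewrite (heq_constant h) /= all_map.
  exact: c.
have ls_i : ls = nseq n.+2 i by rewrite ls_n; exact/all_pred1P.
rewrite {}ls_i {c ls_n ls} in h.
(* A constant word of reflections becomes non-constant when a rotation is
   inverted twice, a Hurwitz move being made in between. *)
have [ls [ls_n nc hls]] : exists ls, [/\ size ls = n.+3, ~~ constant ls &
    heq (Rot Z1 :: refs (nseq n.+3 i)) (Rot Z1 :: refs ls)].
  (* The first two letters cancel, so the product is still that of [i], [i], [i]. *)
  exists ([:: z3add i Z2; z3add i Z2; i] ++ nseq n i).
  split; first by rewrite size_cat size_nseq.
    by case: i {h}.
  rewrite (nseqD 3 n) !map_cat.
  apply: (heq_catr _ (_ : heq [:: _; _; _; _] [:: _; _; _; _])).
  by apply: (@hreach_heq 6); case: i {h}; vm_compute.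
have [p hp] := heq_refs ls_n nc; exists p.
apply: heq_trans h _; rewrite /normal_word.
rewrite -nseq_rcons -!catA; apply: heq_catl; rewrite !cat1s.
exact: heq_trans hls (heq_cons _ hp).
Qed.

(** By parity, a word with trivial product cannot contain exactly one reflection. *)
Lemma d3prod_fst w : (d3prod w).1 = odd (count fst w).
Proof. by elim: w => //= a w IH; rewrite IH oddD; case: a.1. Qed.

Theorem heq_words w w' :
  all (predC1 d3one) w -> all (predC1 d3one) w' ->
  d3prod w = d3one -> d3prod w' = d3one ->
  ~~ constant w -> ~~ constant w' ->
  size w = size w' -> count fst w = count fst w' -> (0 < count fst w)%N ->
  exists g, heq (map (d3conj g) w) w'.
Proof.
move=> w1 w1' p p' nc nc' sw cw; case c : (count fst w) => [//|n] _.
case: n c => [|[|n]] c.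
- by have := d3prod_fst w; rewrite p c.
- have [|i [ls []]] := heq_rot_refs w1; first by rewrite c.
  rewrite c => h []; case: ls h => [|j []] // h _.
  have [|i' [ls' []]] := heq_rot_refs w1'; first by rewrite -cw c.
  rewrite -cw c -sw => h' []; case: ls' h' => [|j' []] // h' _.
  set rs := nseq _ _ in h h'.
  have e : d3prod (refs [:: i; j]) = d3prod (refs [:: i'; j']).
    apply: (can_inj (@d3mulKI (d3prod rs))); rewrite -!d3prod_cat.
    by rewrite -(heq_prod h) -(heq_prod h') p.
  have [k ek] : exists k,
      map (d3conj (Rot k)) (refs [:: i; j]) = refs [:: i'; j'].
    (* Conjugation by [r^k] sends [r^i s] to [r^(i+2k) s = r^(i-k) s]. The equality of products then
       takes care of [j]. *)
    exists (z3add i (z3opp i')).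
    by move: e; case: i {h}; case: j; case: i' {h'}; case: j'.
  exists (Rot k); apply: heq_trans (heq_conj _ h) _.
  apply: heq_trans (heq_sym h'); rewrite map_cat ek map_nseq.
  by rewrite (_ : d3conj _ _ = Rot Z1) //; case: (k).
(* With three reflections or more, the normal forms agree without any conjugation. *)
- have [q h] := heq_normal_word w1 c nc.
  have [|q' h'] := heq_normal_word (n := n) w1' _ nc'; first by rewrite -cw.
  exists d3one; rewrite (eq_map (g := id)) ?map_id; last exact: d3conj1.
  apply: (heq_trans h); apply: (heq_trans _ (heq_sym h')); rewrite -sw.
  rewrite (_ : q = q') //; apply: (@normal_word_prod_inj (size w - n.+3) n).
  by rewrite -(heq_prod h) sw -(heq_prod h') p.
Qed.

(** * Galois tuples as words *)

Local Open Scope group_scope.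

Definition z3nat (k : z3) : nat := match k with Z0 => 0 | Z1 => 1 | Z2 => 2 end.

(** * Non-abelian groups of order 6 as dihedral groups *)

Section Dihedral.
Variables (gT : finGroupType) (r s : gT).
Hypotheses (r3 : r ^+ 3 = 1) (s2 : s ^+ 2 = 1) (rs : r ^ s = r^-1).

Definition d3eval (a : d3) : gT := r ^+ z3nat a.2 * s ^+ a.1.

Lemma d3evalM : {morph d3eval : a b / d3mul a b >-> a * b}.
Proof.
have radd k l : r ^+ z3nat (z3add k l) = r ^+ z3nat k * r ^+ z3nat l.
  rewrite -expgD.
  by case: k; case: l; rewrite //= ?r3 // (expgD _ 3 1) r3 mul1g.
have ropp k : r ^+ z3nat (z3opp k) = r ^- z3nat k.
  apply/eqP; rewrite eq_sym eq_invg_mul -radd.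
  by case: k; rewrite /= expg0.
have sV : s^-1 = s by apply/eqP; rewrite eq_invg_mul -expg2 s2.
have sr k : s * r ^+ k = r ^- k * s.
  by rewrite -expgVn -rs -conjXg conjgE sV !mulgA -[RHS]mulgA -expg2 s2 mulg1.
move=> [e k] [f l]; rewrite /d3eval /= radd -!mulgA; congr (_ * _).
case: e => /=; rewrite ?expg1 ?expg0 ?mul1g // ropp mulgA sr -mulgA.
by congr (_ * _); case: f => /=; rewrite ?expg1 ?expg0 ?mulg1.
Qed.

Lemma d3eval_inj : r != 1 -> injective d3eval.
Proof.
move=> r1 a b ab.
have rr k : r ^+ z3nat k = 1 -> k = Z0.
  case: k => //= rk; case/eqP: r1; first by rewrite -rk expg1.
  by rewrite -r3 (expgD r 2 1) rk mul1g expg1.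
have ker c : d3eval c = 1 -> c = d3one.
  case: c => [[] k] /=; rewrite /d3eval /= ?expg1 ?expg0 ?mulg1;
    last by move/rr->.
  (* Here [s] is a power of [r], so it commutes with [r]; with [r ^ s = r^-1] this gives
     [r^2 = 1]. *)
  move/eqP; rewrite -eq_invg_mul => /eqP sk; suff /rr : r ^+ z3nat Z2 = 1 by [].
  have : r ^ s = r by rewrite -sk; apply/conjg_fixP/commgP/commuteV/commuteX.
  by rewrite rs => /eqP; rewrite eq_invg_mul => /eqP.
have : d3mul (d3inv b) a = d3one.
  apply: ker; rewrite d3evalM ab -d3evalM.
  by rewrite -[X in d3mul _ X]d3mulr1 d3mulKI /d3eval /= !expg0 mulg1.
by clear ab; d3cases.
Qed.

Lemma d3eval_surj x : x \in <[r]> * <[s]> -> exists a, x = d3eval a.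
Proof.
case/mulsgP=> _ _ /cycleP[i ->] /cycleP[j ->] ->.
rewrite -(expg_mod i r3) -(expg_mod j s2) modn2.
have : (i %% 3 < 3)%N by rewrite ltn_mod.
case: (i %% 3)%N => [|[|[|]]] // _.
- by exists (odd j, Z0).
- by exists (odd j, Z1).
- by exists (odd j, Z2).
Qed.

End Dihedral.

(** Cauchy gives [r] and [s] of orders 3 and 2. The subgroup [<[r]>] has index 2, hence is normal,
    and [r ^ s] is a power of [r]: exponent 0 would kill [r], exponent 1 would make [G] abelian, so
    the exponent is 2. *)
Lemma nonabelian_order6 (gT : finGroupType) (G : {group gT}) :
  #|G| = 6 -> ~~ abelian G ->
  exists r s, [/\ r != 1, r ^+ 3 = 1, s ^+ 2 = 1, r ^ s = r^-1 &
               (G :=: <[r]> * <[s]>)%g].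
Proof.
move=> G6 nab.
have [|r Gr or] := Cauchy (isT : prime 3) (_ : 3 %| #|G|); first by rewrite G6.
have [|s Gs os] := Cauchy (isT : prime 2) (_ : 2 %| #|G|); first by rewrite G6.
have r3 : r ^+ 3 = 1 by rewrite -or expg_order.
have rG : <[r]> \subset G by rewrite cycle_subG.
have sG : <[s]> \subset G by rewrite cycle_subG.
have GE : (G :=: <[r]> * <[s]>)%g.
  apply/eqP; rewrite eq_sym eqEcard mul_subG //=.
  by rewrite coprime_cardMg -!orderE or os ?G6.
have r1 : r != 1 by rewrite -order_eq1 or.
exists r, s; split=> //; first by rewrite -os expg_order.
have nr : <[r]> <| G.
  apply: index2_normal => //.
  have := Lagrange rG; rewrite G6 -orderE or => /eqP.
  by rewrite (@eqn_pmul2l 3 _ 2) => // /eqP.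
have : r ^ s \in <[r]>.
  by rewrite memJ_norm ?cycle_id // (subsetP (normal_norm nr)).
case/cycleP=> k; rewrite -(expg_mod k r3).
have : (k %% 3 < 3)%N by rewrite ltn_mod.
case: (k %% 3)%N => [|[|[|]]] // _ e.
- by case/eqP: r1; apply/eqP; rewrite -(conjg_eq1 r s) e expg0.
- case/negP: nab; rewrite GE abelianM !cycle_abelian /=.
  rewrite cent_cycle cycle_subG; apply/cent1P.
  by apply: commute_sym; apply/commgP/conjg_fixP; rewrite e expg1.
- by rewrite e; apply/eqP; rewrite eq_sym eq_invg_mul -expgS r3.
Qed.

(* Cayley's embedding, up to a relabelling of the fibre. *)
Definition regular_embedding (f : d3 -> 'S_6) : Prop :=
  {morph f : a b / d3mul a b >-> a * b} /\ bijective (fun a => f a ord0).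

Lemma regular_embedding_inj f : regular_embedding f -> injective f.
Proof. by case=> _ [g fK _] a b ab; rewrite -(fK a) ab fK. Qed.

Lemma regular_embedding1 f : regular_embedding f -> f d3one = 1.
Proof.
by case=> fM _; apply: (mulgI (f d3one)); rewrite -fM mulg1.
Qed.

Lemma regular_embedding_eq1 f a :
  regular_embedding f -> (f a == 1) = (a == d3one).
Proof.
move=> fE; rewrite -(regular_embedding1 fE).
exact: (inj_eq (regular_embedding_inj fE)).
Qed.

Lemma regular_embeddingJ f a b :
  regular_embedding f -> f (d3conj a b) = f a * f b * (f a)^-1.
Proof. by case=> fM _; apply: (canRL (mulgK _)); rewrite -!fM d3conjK. Qed.

(** The bijection sending [f a ord0] to [f' a ord0] intertwines the two regular actions. *)
Lemma regular_embedding_conj f f' :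
  regular_embedding f -> regular_embedding f' ->
  exists s, forall a, f a ^ s = f' a.
Proof.
move=> [fM [g fK gK]] [fM' [g' fK' gK']].
have sinj : injective (fun x => f' (g x) ord0).
  by apply: inj_comp (can_inj fK') (can_inj gK).
exists (perm sinj) => a; apply/permP => x.
rewrite -(gK' x) -[f' (g' x) ord0](_ : perm sinj (f (g' x) ord0) = _);
  last first.
  by rewrite permE fK.
by rewrite permJ !permE -permM -fM !fK fM' permM.
Qed.

(** If [g] and [h] agree at [ord0], they agree at every [d ord0] with [d] in [H], since [d] commutes
    with both. *)
Lemma regular_of_transitive (G H : {group 'S_6}) : H \subset 'C(G) ->
  [transitive H, on [set: 'I_6] | 'P] ->
  {in G &, injective (fun g : 'S_6 => g ord0)}.
Proof.
move=> cGH trH g h Gg Gh /= gh; apply/permP => x.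
have [d Hd ->] := atransP2 trH (in_setT ord0) (in_setT x).
rewrite /= /aperm -!permM.
have cd y : y \in G -> d * y = y * d.
  by move=> Gy; apply: (centP (subsetP cGH _ Hd)).
by rewrite !cd // !permM gh.
Qed.

Lemma card_regular (G H : {group 'S_6}) : H \subset 'C(G) ->
  [transitive G, on [set: 'I_6] | 'P] -> [transitive H, on [set: 'I_6] | 'P] ->
  #|G| = 6.
Proof.
move=> cGH trG /(regular_of_transitive cGH) inj.
by rewrite -(card_in_imset inj) -[RHS](card_ord 6) -cardsT
  -(atransP trG ord0) ?inE.
Qed.

Lemma S3_nonabelian : ~~ abelian [set: 'S_3].
Proof.
pose i1 : 'I_3 := Ordinal (isT : 1 < 3)%N.
apply/negP => /centsP/(_ _ (in_setT (tperm ord0 i1))).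
move=> /(_ _ (in_setT (tperm i1 ord_max)))/permP/(_ ord0).
by rewrite !permM !permE /= ?permE /=.
Qed.

(** * Words attached to Galois tuples *)

Section Tuples.
Variable b : nat.
Implicit Types t : monodromy_tuple b.

Lemma galois_S3_regular t : galois_S3_tuple t ->
  ~~ abelian (monodromy_group t) /\
  exists2 f, regular_embedding f & forall i, exists a, val t i = f a.
Proof.
case=> trM isoD trD; set M := monodromy_group t in trM *.
have M6 : #|M| = 6 by apply: card_regular trM trD.
have nab : ~~ abelian M.
  apply: contraL (S3_nonabelian) => abM; rewrite negbK.
  (* An abelian [M] lies in its centraliser, which has the same order 6. *)
  have DM : deck_group t :=: M.
    apply/eqP; rewrite eq_sym eqEcard (card_isog isoD) cardsT card_Sn M6 andbT.
    exact: abM.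
  by rewrite -(isog_abelian isoD) DM.
split=> //; have [r [s [r1 r3 s2 rs ME]]] := nonabelian_order6 M6 nab.
have fM := d3evalM r3 s2 rs; have finj := d3eval_inj r3 s2 rs r1.
have fMem a : d3eval r s a \in M by rewrite ME mem_mulg ?mem_cycle.
have fsurj x : x \in M -> exists a, x = d3eval r s a.
  by rewrite ME; apply: d3eval_surj.
exists (d3eval r s); last first.
  by move=> i; apply: fsurj; apply/mem_gen/imsetP; exists i.
split=> //.
have inj0 : injective (fun a => d3eval r s a ord0).
  move=> a c ac; apply: finj.
  by apply: (regular_of_transitive (subxx _) trD); rewrite ?fMem.
have surj0 x : exists a, d3eval r s a ord0 == x.
  have [m Mm ->] := atransP2 trM (in_setT ord0) (in_setT x).
  by have [a ->] := fsurj m Mm; exists a.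
exists (fun x => xchoose (surj0 x)) => x; last exact/eqP/(xchooseP (surj0 x)).
by apply: inj0; apply/eqP/(xchooseP (surj0 _)).
Qed.

(** The default value of [nth] is not reached when [size w = b], as [relator] demands. *)
Definition word_tuple (f : d3 -> 'S_6) (w : seq d3) : {ffun 'I_b -> 'S_6} :=
  [ffun i : 'I_b => f (nth d3one w i)].

Definition relator w : bool :=
  [&& size w == b, all (predC1 d3one) w & d3prod w == d3one].

Lemma prod_word_tuple f w : regular_embedding f -> size w = b ->
  \prod_(i < b) word_tuple f w i = f (d3prod w).
Proof.
move=> fE sw; rewrite (eq_bigr (fun i : 'I_b => f (nth d3one w i))); last first.
  by move=> i _; rewrite ffunE.
rewrite -sw -(big_mkord xpredT (fun i => f (nth d3one w i))).
rewrite -(big_nth d3one xpredT f).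
elim: w {sw} => [|a w IH]; first by rewrite big_nil regular_embedding1.
by rewrite big_cons IH /= (proj1 fE).
Qed.

Lemma relatorP f w : regular_embedding f -> size w = b ->
  relator w = [forall i, word_tuple f w i != 1] &&
              (\prod_(i < b) word_tuple f w i == 1).
Proof.
move=> fE sw; rewrite /relator sw eqxx /= prod_word_tuple //.
rewrite regular_embedding_eq1 //; congr (_ && _).
apply/allP/forallP => [w1 i|w1 a aw].
  by rewrite ffunE regular_embedding_eq1 //; apply/w1/mem_nth; rewrite sw.
have ib : (index a w < b)%N by rewrite -sw index_mem.
by have := w1 (Ordinal ib); rewrite ffunE /= nth_index // regular_embedding_eq1.
Qed.

Lemma relator_tuple f w : regular_embedding f -> relator w ->
  exists t, val t = word_tuple f w.
Proof.
move=> fE rw; have /and3P[/eqP sw _ _] := rw.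
rewrite (relatorP fE sw) in rw.
by exists (Sub (word_tuple f w) rw); rewrite SubK.
Qed.

Lemma galois_S3_word t : galois_S3_tuple t ->
  exists f w, [/\ regular_embedding f, relator w, val t = word_tuple f w,
                  ~~ constant w & (0 < count fst w)%N].
Proof.
case/galois_S3_regular=> nab [f fE /fin_all_exists[g tg]].
pose w := [seq g i | i <- enum 'I_b].
have sw : size w = b by rewrite size_map size_enum_ord.
have tE : val t = word_tuple f w.
  apply/ffunP => i; rewrite ffunE tg (nth_map i) ?size_enum_ord //.
  by rewrite nth_ord_enum.
have rw : relator w by rewrite (relatorP fE sw) -tE (valP t).
(* Commuting letters would make the monodromy group abelian; this excludes constant words and words
   of rotations alike. *)
have comm : (forall a c, a \in w -> c \in w -> d3mul a c = d3mul c a) -> False.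
  move=> cw; case/negP: nab; rewrite abelian_gen; apply/centsP.
  have gw i : g i \in w by rewrite map_f ?mem_enum.
  move=> _ /imsetP[i _ ->] _ /imsetP[j _ ->]; rewrite /commute !tg.
  by rewrite -!(proj1 fE) cw.
exists f, w; split=> //.
  apply/negP => /(constantP d3one)[x wx]; apply: comm => a c.
  by rewrite wx => /nseqP[-> _] /nseqP[-> _].
rewrite lt0n; apply/negP => /eqP w0; apply: comm.
have rot a : a \in w -> a.1 = false.
  move=> aw; apply/negP => a1.
  by have : has fst w; [apply/hasP; exists a|rewrite has_count w0].
by move=> [e k] [e1 l] /rot /= -> /rot /= ->; case: k; case: l.
Qed.

(** * From equivalence of words to equivalence of tuples *)

Inductive tuple_step t t' : Prop :=
| TupleConj s of val t' = conj_tuple s (val t)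
| TupleHurwitz (i j : 'I_b) of (j : nat) = i.+1
    & val t' = hurwitz_move i j (val t).

Definition tuple_equiv := clos_refl_sym_trans _ tuple_step.

Lemma word_tuple_hstep f u a c v (i j : 'I_b) : regular_embedding f ->
  i = size u :> nat -> j = i.+1 :> nat ->
  word_tuple f (u ++ d3conj a c :: a :: v) =
  hurwitz_move i j (word_tuple f (u ++ a :: c :: v)).
Proof.
move=> fE iu ji; apply/ffunP => k; rewrite !ffunE !nth_cat ji iu.
have -> : ((size u).+1 < size u)%N = false by rewrite ltnNge leqnSn.
rewrite ltnn subnn subSnn /= -!val_eqE /= ji iu.
case: (ltngtP k (size u)) => [ku|ku|->].
- by rewrite ltn_eqF // (ltn_trans ku).
- have [->|ne] := eqVneq (k : nat) (size u).+1.
    by rewrite subSnn.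
  have k2 : ((size u).+2 <= k)%N by rewrite ltn_neqAle eq_sym ne.
  by rewrite -(subnKC k2) !addSn -!addnS addKn.
- by rewrite subnn regular_embeddingJ.
Qed.

(** Length, product and absence of trivial letters are invariant, so every intermediate word is
    again a relator and defines a monodromy tuple. *)
Lemma heq_tuple_equiv f w w' t t' : regular_embedding f -> heq w w' ->
  relator w -> val t = word_tuple f w -> val t' = word_tuple f w' ->
  tuple_equiv t t'.
Proof.
move=> fE h; have relE u v : heq u v -> relator u = relator v.
  move=> uv.
  by rewrite /relator (heq_size uv) (heq_nonid uv) (heq_prod uv).
elim: h t t' => {w w'} [_ _ [u a c v]|w|w w' h IH|w w2 w' h1 IH1 h2 IH2]
  t t' rw e e'.
- have ub : ((size u).+1 < b)%N.
    by case/and3P: rw => /eqP <- _ _; rewrite size_cat !addnS !ltnS leq_addr.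
  apply/rst_step/(@TupleHurwitz _ _ (Ordinal (ltnW ub)) (Ordinal ub)) => //.
  by rewrite e' e; apply: word_tuple_hstep.
- suff -> : t = t' by apply: rst_refl.
  by apply: val_inj; rewrite e e'.
- by apply/rst_sym/IH => //; rewrite (relE _ _ h).
- have rw2 : relator w2 by rewrite -(relE _ _ h1).
  have [t2 e2] := relator_tuple fE rw2.
  by apply: rst_trans (IH1 _ _ rw e e2) (IH2 _ _ rw2 e2 e').
Qed.

Lemma regular_embedding_ref_class f a : regular_embedding f ->
  (f a \in f (Ref Z0) ^: [set: 'S_6]) = a.1.
Proof.
move=> fE; have fM := proj1 fE; case: a => [[] k] /=.
  (* Indeed [r^(-k) s r^k = r^(-2k) s = r^k s]. *)
  apply/imsetP; exists (f (Rot k)); first by rewrite inE.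
  by rewrite conjgE -[LHS](mulKg (f (Rot k))) -!fM; case: k.
(* A rotation has trivial cube, whereas the cube of a reflection is the reflection itself. *)
apply/imsetP => -[s _ e].
have f3 : f (Rot k) ^+ 3 = 1.
  by rewrite -(regular_embedding1 fE) !expgS expg0 mulg1 -!fM; case: k {e}.
move: f3; rewrite e -conjXg => /eqP; rewrite conjg_eq1 !expgS expg0 mulg1.
by rewrite -!fM regular_embedding_eq1.
Qed.

Lemma tuple_type_ref f w t : regular_embedding f -> relator w ->
  val t = word_tuple f w ->
  tuple_type t (f (Ref Z0) ^: [set: 'S_6]) = count fst w.
Proof.
move=> fE /and3P[/eqP sw _ _] e; rewrite /tuple_type -sum1_card -sum1_count.
rewrite (big_nth d3one) big_mkord sw; apply: eq_bigl => i.
by rewrite inE e ffunE regular_embedding_ref_class.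
Qed.

Theorem galois_S3_tuple_equiv t t' :
  galois_S3_tuple t -> galois_S3_tuple t' ->
  {in nonid_classes, tuple_type t =1 tuple_type t'} -> tuple_equiv t t'.
Proof.
case/galois_S3_word=> f [w [fE rw e nc c]].
case/galois_S3_word=> f' [w' [fE' rw' e' nc' c']] ty.
have [s fs] := regular_embedding_conj fE fE'.
(* Reading [w] through [f'] instead of [f] amounts to conjugating [t]; both words are then read
   through the same embedding. *)
have [t1 e1] := relator_tuple fE' rw.
have st1 : val t1 = conj_tuple s (val t).
  by rewrite e1 e; apply/ffunP => i; rewrite !ffunE fs.
have cw : count fst w = count fst w'.
  rewrite -(tuple_type_ref fE' rw e1) -(tuple_type_ref fE' rw' e').
  set C := _ ^: _.
  have CC : C \in classes [set: 'S_6] by rewrite mem_classes ?inE.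
  rewrite (tuple_type_conj CC st1) ty // !inE CC andbT.
  apply/eqP => C1; have := class_refl [set: 'S_6] (f' (Ref Z0)).
  by rewrite -/C C1 inE regular_embedding_eq1.
have /and3P[/eqP sw w1 /eqP p] := rw; have /and3P[/eqP sw' w1' /eqP p'] := rw'.
have [|g hg] := heq_words w1 w1' p p' nc nc' _ cw c; first by rewrite sw.
have rg : relator (map (d3conj g) w).
  by rewrite /relator (heq_size hg) (heq_nonid hg) (heq_prod hg).
have [t2 e2] := relator_tuple fE' rg.
apply: rst_trans (rst_step _ _ _ _ (TupleConj st1)) _.
apply: rst_trans (heq_tuple_equiv fE' hg rg e2 e').
(* The inverse appears because [x ^ s] is [s^-1 * x * s], while [d3conj g] puts [g] on the left. *)
apply/rst_step/(@TupleConj _ _ (f' g)^-1).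
rewrite e2 e1; apply/ffunP => i; rewrite !ffunE (nth_map d3one) ?sw //.
by rewrite regular_embeddingJ // conjgE invgK mulgA.
Qed.

(** Every local monodromy is non-trivial and lies in exactly one class. The type therefore
    determines the number of branch points. *)
Lemma sum_tuple_type t : \sum_(C in nonid_classes) tuple_type t C = b.
Proof.
rewrite (eq_bigr (fun C : {set 'S_6} => \sum_(i < b) (val t i \in C)));
  last first.
  move=> C _; rewrite /tuple_type -sum1_card big_mkcond /=.
  by apply: eq_bigr => i _; rewrite inE; case: ifP.
rewrite exchange_big /= -[RHS](card_ord b) -sum1_card; apply: eq_bigr => i _.
have /andP[/forallP/(_ i) ti _] := valP t.
have Ci : val t i ^: [set: 'S_6] \in nonid_classes.
  rewrite !inE mem_classes ?inE // andbT.
  apply: contraNneq ti => Ci; rewrite -in_set1 -Ci; exact: class_refl.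
rewrite (bigD1 _ Ci) /= class_refl big1 // => C.
case/andP=> [/setD1P[_ /imsetP[c _ ->]] ne].
apply/eqP; rewrite eqb0; apply: contra ne => /class_eqP ->; exact: eqxx.
Qed.

End Tuples.

Local Close Scope group_scope.

(** * Connected components of the Hurwitz space *)

From mathcomp Require Import all_order all_algebra generic_quotient lra.
From mathcomp Require Import all_classical all_reals all_analysis.

Import Order.TTheory GRing.Theory Num.Theory.
Import numFieldNormedType.Exports.

Local Open Scope classical_set_scope.
Local Open Scope ring_scope.
Local Open Scope quotient_scope.

(** * Half-twist loops in the configuration space *)

Section Paths.
Variables (R : realType) (b : nat).

Lemma conf_injective (x : P1pow R b) :
  injective x -> conf (\pi_(sym_prod R b) x).
Proof.
move=> xinj [y ninj /eqmodP/asboolP[s xy]]; apply: ninj => i j yij.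
have yx k : y k = x ((s^-1)%g k) by rewrite xy permKV.
by apply: (perm_inj (s := s^-1%g)); apply: xinj; rewrite -!yx.
Qed.

Lemma conf_base : conf (base_conf R b).
Proof.
apply: conf_injective => i j [] /eqP; rewrite eqr_nat => /eqP.
exact: val_inj.
Qed.

(** The moving points are antipodal on the circle of radius 1/2 about [i + 1/2], hence distinct.
    They meet the real axis only at [i] and [i + 1], where no fixed point lies. *)
Lemma half_twist_conf (i j : 'I_b) (u : R) :
  (j : nat) = i.+1 -> conf (half_twist i j u).
Proof.
move=> ji; apply: conf_injective.
set c := cos (pi * u); set s := sin (pi * u).
have cs : c ^+ 2 + s ^+ 2 = 1 by rewrite cos2Dsin2.
have jR : (j : nat)%:R = (i : nat)%:R + 1 :> R by rewrite ji -natr1.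
have nsq (k : 'I_b) (e : R) : e = 1 \/ e = -1 ->
    (i : nat)%:R + 2^-1 - e / 2 = (k : nat)%:R -> k = i \/ k = j.
  case=> -> h; [left|right]; apply/val_inj/eqP; rewrite -(eqr_nat R) -h ?jR;
    apply/eqP; lra.
have c1 : s = 0 -> c = 1 \/ c = -1.
  move=> s0; move: cs; rewrite s0 expr0n addr0 => /eqP.
  by rewrite sqrf_eq1 => /orP[] /eqP ->; [left|right].
move=> k l /=; have [->|ki] := eqVneq k i; have [->|li] := eqVneq l i => //.
- have [->|lj] := eqVneq l j; move=> [h1 h2].
    have c0 : c = 0 by lra.
    have s0 : s = 0 by lra.
    by move: cs; rewrite c0 s0 !expr0n addr0 => /eqP; rewrite eq_sym oner_eq0.
  have s0 : s = 0 by lra.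
  by case: (nsq l c (c1 s0) h1) => e;
    [rewrite e eqxx in li|rewrite e eqxx in lj].
- have [->|kj] := eqVneq k j; move=> [h1 h2].
    have c0 : c = 0 by lra.
    have s0 : s = 0 by lra.
    by move: cs; rewrite c0 s0 !expr0n addr0 => /eqP; rewrite eq_sym oner_eq0.
  have s0 : s = 0 by lra.
  by case: (nsq k c (c1 s0) (esym h1)) => e;
    [rewrite e eqxx in ki|rewrite e eqxx in kj].
- have [->|kj] := eqVneq k j; have [->|lj] := eqVneq l j => // -[].
  + move=> h1 h2; have s0 : s = 0 by lra.
    have cN : - c = 1 \/ - c = -1.
      by case: (c1 s0) => ->; rewrite ?opprK; [right|left].
    have h : (i : nat)%:R + 2^-1 - (- c) / 2 = (l : nat)%:R by rewrite -h1; lra.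
    by case: (nsq l _ cN h) => e; [rewrite e eqxx in li|rewrite e eqxx in lj].
  + move=> h1 h2; have s0 : s = 0 by lra.
    have cN : - c = 1 \/ - c = -1.
      by case: (c1 s0) => ->; rewrite ?opprK; [right|left].
    have h : (i : nat)%:R + 2^-1 - (- c) / 2 = (k : nat)%:R by rewrite h1; lra.
    by case: (nsq k _ cN h) => e; [rewrite e eqxx in ki|rewrite e eqxx in kj].
  + by move=> /eqP; rewrite eqr_nat => /eqP/val_inj.
Qed.

Lemma half_twist0 (i j : 'I_b) :
  (j : nat) = i.+1 -> half_twist i j (0 : R) = base_conf R b.
Proof.
move=> ji; have jR : (j : nat)%:R = (i : nat)%:R + 1 :> R by rewrite ji -natr1.
congr (\pi_ _ _); apply/funext => k.
rewrite mulr0 cos0 sin0 mul0r oppr0.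
have [->|ki] := eqVneq k i; first by congr (Some (_, _)); lra.
have [->|//] := eqVneq k j; congr (Some (_, _)); rewrite jR; lra.
Qed.

(** At time 1 the two points have exchanged places: the loop closes up in the symmetric product,
    through [tperm i j]. *)
Lemma half_twist1 (i j : 'I_b) :
  (j : nat) = i.+1 -> half_twist i j (1 : R) = base_conf R b.
Proof.
move=> ji; have jR : (j : nat)%:R = (i : nat)%:R + 1 :> R by rewrite ji -natr1.
have ij : i != j by rewrite -val_eqE /= ji neq_ltn ltnSn.
apply/eqmodP/asboolP; exists (tperm i j) => k.
rewrite mulr1 cospi sinpi mul0r oppr0.
case: tpermP => [->|->|/eqP/negbTE ki /eqP/negbTE kj].
- rewrite eq_sym (negbTE ij) eqxx.
  by congr (Some (_, _)); lra.
- by rewrite eqxx; congr (Some (_, _)); rewrite jR; lra.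
- by rewrite ki kj.
Qed.

Lemma P1pow_continuous (T : topologicalType) (f : T -> P1pow R b) :
  (forall k, continuous (fun x => f x k)) -> continuous f.
Proof.
move=> fc x; apply/cvg_sup => k; move: x.
apply/(@continuousP _ (initial_topology (@^~ k))) => A [B oB <-].
exact: (proj1 (continuousP _) (fc k)).
Qed.

Lemma half_twist_continuous (i j : 'I_b) : continuous (@half_twist R b i j).
Proof.
pose f (v : R) : P1pow R b := fun k : 'I_b =>
  let c : R := (i : nat)%:R + 2^-1 in
  if k == i then Some (c - cos (pi * v) / 2, sin (pi * v) / 2)
  else if k == j then Some (c + cos (pi * v) / 2, - (sin (pi * v) / 2))
  else Some ((k : nat)%:R, 0).
have fcts : continuous f.
  have mulc (v : R) : {for v, continuous (fun v : R => pi * v)}.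
    exact: mulrl_continuous.
  have ccts (v : R) : {for v, continuous (fun v : R => cos (pi * v) / 2)}.
    apply: continuousM; last exact: cst_continuous.
    by apply: continuous_comp; [exact: mulc|exact: continuous_cos].
  have scts (v : R) : {for v, continuous (fun v : R => sin (pi * v) / 2)}.
    apply: continuousM; last exact: cst_continuous.
    by apply: continuous_comp; [exact: mulc|exact: continuous_sin].
  have pcts (g h : R -> R) (v : R) :
      {for v, continuous g} -> {for v, continuous h} ->
      {for v, continuous (fun v => Some (g v, h v) : P1 R)}.
    move=> gc hc; apply: (continuous_comp (f := fun v => (g v, h v))).
      exact: (cvg_pair gc hc).
    exact: one_point_compactification_some_continuous.
  apply: P1pow_continuous => k v; rewrite /f.
  case: eqVneq => _; last case: eqVneq => _; last exact: cst_continuous.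
  - apply: pcts (scts v); apply: continuousB (ccts v); exact: cst_continuous.
  - apply: (pcts (fun v => _ + _) (fun v => - _));
      last by apply: continuousN; exact: scts.
    apply: continuousD (ccts v); exact: cst_continuous.
move=> u; apply: (continuous_comp (f := f)); first exact: fcts.
exact: (@pi_continuous _ (sym_prod R b)).
Qed.

(** * Contraction of paths *)

Lemma conf_path_eq (p q : conf_path R b) : p =1 q -> p = q.
Proof.
case: p q => [p pc pf pb] [q qc qf qb] /= /funext pq; subst q.
by congr ConfPath; exact: Prop_irrelevance.
Qed.

Lemma scaled_continuous (p : conf_path R b) (s : R) :
  continuous (fun u => p (s * u)).
Proof.
move=> u; apply: continuous_comp; first exact: mulrl_continuous.
exact: path_continuous.
Qed.

Lemma scaled_base (p : conf_path R b) (s : R) : p (s * 0) = base_conf R b.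
Proof. by rewrite mulr0 path_base. Qed.

(** Joins the constant path ([s = 0]) to [p] ([s = 1]). The endpoint [p s] moves with [s], so this
    traces a path in the Hurwitz space rather than a homotopy with fixed ends. *)
Definition scale_path (p : conf_path R b) (s : R) : conf_path R b :=
  ConfPath (@scaled_continuous p s) (fun u => @path_conf _ _ p (s * u))
    (scaled_base p s).

(** The topology on paths is induced from the compact-open one, so currying the continuous map
    [(s, u) |-> p (s * u)] suffices. *)
Lemma scale_path_continuous (p : conf_path R b) : continuous (scale_path p).
Proof.
apply/continuousP => A [B oB <-].
have : continuous (curry (fun z : R * R => p (z.1 * z.2))
    : R -> {compact-open, R -> sym_prod R b}).
  apply: continuous_curry_fun => z.
  apply: (continuous_comp (f := fun z : R * R => z.1 * z.2)).
    exact: mul_continuous.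
  exact: path_continuous.
by move/continuousP; apply.
Qed.

Definition const_path : conf_path R b :=
  ConfPath (@cst_continuous R _ (base_conf R b))
    (fun=> conf_base) (erefl (base_conf R b)).

(** Clamping [2 * u] to [[0, 1]] yields a path on all of [R]: the half twist up to time 1/2, then a
    constant. *)
Lemma twist_path_continuous (i j : 'I_b) :
  continuous (fun u : R => half_twist i j (Num.min 1 (Num.max 0 (2 * u)))).
Proof.
move=> u; apply: continuous_comp; last exact: half_twist_continuous.
apply: continuous_min; first exact: cst_continuous.
apply: continuous_max; first exact: cst_continuous.
exact: mulrl_continuous.
Qed.

Lemma half_twist_path (i j : 'I_b) : (j : nat) = i.+1 ->
  exists q : conf_path R b, half_twist_then i j const_path q.
Proof.
move=> ji.
have base : half_twist i j (Num.min 1 (Num.max 0 (2 * 0)) : R) = base_conf R b.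
  by rewrite mulr0 maxxx min_r ?ler01 ?half_twist0.
exists (ConfPath (@twist_path_continuous i j)
  (fun=> @half_twist_conf i j _ ji) base).
split=> u /andP[u0 u1] /=.
- congr half_twist; rewrite max_r ?min_r //; lra.
- by rewrite max_r ?min_l ?half_twist1 //; lra.
Qed.

(** * Paths between points of the Hurwitz space *)

Definition hur_point (p : conf_path R b) (t : monodromy_tuple b) : HUR R :=
  existT (HUR6 R) b (\pi_(HUR6 R b) ((p, t) : hur_pre R b)).

Lemma hur_point_S3 p t : HUR_S3 (hur_point p t) <-> galois_S3_tuple t.
Proof. exact: galois_S3_tuple_pi. Qed.

Lemma hur_point_step p t q t' :
  hur_step (p, t) (q, t') -> hur_point p t = hur_point q t'.
Proof.
by move=> st; congr existT; apply/eqmodP/asboolP; apply: rst_step.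
Qed.

Lemma hur_point_continuous t : continuous (hur_point^~ t).
Proof.
move=> p; apply: continuous_comp; last exact: existT_continuous.
apply: (continuous_comp (f := fun p => (p, t) : hur_pre R b)).
  have ct : {for p, continuous (fun _ : conf_path R b =>
      t : discrete_topology (monodromy_tuple b))} by exact: cst_continuous.
  exact: (cvg_pair cvg_id ct).
exact: (@pi_continuous _ (HUR6 R b)).
Qed.

Lemma hur_point_contract p t : galois_S3_tuple t ->
  connected_component (@HUR_S3 R) (hur_point const_path t) (hur_point p t).
Proof.
move=> gt; pose F s := hur_point (scale_path p s) t.
have F0 : F 0 = hur_point const_path t.
  congr hur_point; apply: conf_path_eq => u /=.
  by rewrite mul0r path_base.
have F1 : F 1 = hur_point p t.
  by congr hur_point; apply: conf_path_eq => u /=; rewrite mul1r.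
exists (F @` `[0, 1]); last by exists 1 => //=; rewrite in_itv /= ler01 lexx.
split; first by exists 0 => //=; rewrite in_itv /= ler01 lexx.
  by move=> _ [s _ <-]; apply/hur_point_S3.
apply: connected_continuous_connected; first exact: segment_connected.
apply: continuous_subspaceT => s.
apply: (continuous_comp (f := scale_path p) (g := hur_point^~ t)).
  exact: scale_path_continuous.
exact: hur_point_continuous.
Qed.

Lemma tuple_step_component t t' : tuple_step t t' ->
  (galois_S3_tuple t <-> galois_S3_tuple t') /\
  (galois_S3_tuple t -> connected_component (@HUR_S3 R)
     (hur_point const_path t) (hur_point const_path t')).
Proof.
(* Contracting [q] then joins the two points, and their common class transfers the Galois
   property. *)
move=> tt'; suff [q e] : exists q, hur_point q t = hur_point const_path t'.
  split; last by move=> gt; rewrite -e; exact: hur_point_contract.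
  by rewrite -(hur_point_S3 q t) e hur_point_S3.
case: tt' => [s e|i j ji e].
  by exists const_path; apply: hur_point_step; exact: hur_conj e.
have [q hq] := half_twist_path ji.
by exists q; apply: hur_point_step; exact: hur_hurwitz ji hq e.
Qed.

Lemma tuple_equiv_component t t' : tuple_equiv t t' -> galois_S3_tuple t ->
  connected_component (@HUR_S3 R)
    (hur_point const_path t) (hur_point const_path t').
Proof.
(* The equivalence of the Galois properties is carried along so that the symmetric and transitive
   cases of the induction go through. *)
move=> tt'; suff [] : (galois_S3_tuple t <-> galois_S3_tuple t') /\
  (galois_S3_tuple t -> connected_component (@HUR_S3 R)
     (hur_point const_path t) (hur_point const_path t')) by [].
elim: tt' => {t t'} [t t'|t|t t' _ [g c]|t t1 t' _ [g c] _ [g' c']].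
- exact: tuple_step_component.
- split=> // gt; apply: connected_component_refl; exact/hur_point_S3.
- by split=> [|/g /c /connected_component_sym]; first exact: iff_sym.
- split; first exact: iff_trans g g'.
  by move=> gt; apply: connected_component_trans (c gt) (c' (g.1 gt)).
Qed.

End Paths.

Theorem theorem3p7 (R : realType) (h h' : HUR R) :
  HUR_S3 h -> HUR_S3 h' -> same_monodromy_type h h' ->
  exists Z : set (HUR R), [/\ irreducible_component Z, Z h & Z h'].
Proof.
move=> gh gh' ty; exists (connected_component (@HUR_S3 R) h).
split; [by exists h | exact: connected_component_refl |].
case: h h' gh gh' ty => [b x] [b' x'] gt gt' ty.
have bb' : b = b'.
  rewrite -(sum_tuple_type (fibre_tuple x)) -(sum_tuple_type (fibre_tuple x')).
  by apply: eq_bigr => C /ty.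
subst b'; move: gt gt' ty; rewrite -(reprK x) -(reprK x').
case: (repr x) => p t; case: (repr x') => p' t' gt gt' ty.
have {}gt : galois_S3_tuple t by apply/(hur_point_S3 p).
have {}gt' : galois_S3_tuple t' by apply/(hur_point_S3 p').
have tt' : tuple_equiv t t'.
  apply: galois_S3_tuple_equiv => // C Cn.
  by rewrite -(tuple_type_pi (p, t) Cn) -(tuple_type_pi (p', t') Cn); apply: ty.
(* The chain runs from [(p, t)] to [(const_path, t)], then to [(const_path, t')], then to
   [(p', t')]. *)
apply: connected_component_trans (hur_point_contract p' gt').
apply: connected_component_trans (tuple_equiv_component R tt' gt).
exact/connected_component_sym/hur_point_contract.
Qed.
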